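(* Let $m\ge 3$ and $n\ge 2$ be integers and let $\mathscr{A}\in\mathbb{T}_{m,n}$ be a strong $P_0$-tensor ($SP_0$-tensor). Then the following four properties are equivalent: (1) $\mathscr{A}$ is an $R_0$-tensor; (2) $\mathscr{A}$ is an $R$-tensor; (3) $\mathscr{A}$ is an $ER$-tensor; (4) $\mathscr{A}$ is a $Q$-tensor.
   Context: $[n]=\{1,\ldots,n\}$, $\mathbb{R}^n_+=\{x\in\mathbb{R}^n:x\ge 0\}$ (componentwise), $\mathbb{R}_+=[0,\infty)$. $\mathbb{T}_{m,n}$ is the set of real $m$-order $n$-dimensional tensors $\mathscr{A}=(a_{i_1\cdots i_m})$, $a_{i_1\cdots i_m}\in\mathbb{R}$ for $i_1,\ldots,i_m\in[n]$ (no symmetry assumed). For $x\in\mathbb{R}^n$, $\mathscr{A}x^{m-1}\in\mathbb{R}^n$ is defined by $(\mathscr{A}x^{m-1})_i=\sum_{i_2,\ldots,i_m=1}^n a_{ii_2\cdots i_m}x_{i_2}\cdots x_{i_m}$. $SP_0$-tensor: $f(x):=\mathscr{A}x^{m-1}+q$ (with $q\in\mathbb{R}^n$; the property does not depend on $q$) is a $P_0$-function, i.e. for all $x,y\in\mathbb{R}^n$ with $x\ne y$ there is $i\in[n]$ with $x_i\ne y_i$ and $(x_i-y_i)[f_i(x)-f_i(y)]\ge 0$. $R$-tensor: there is no $(x,t)\in(\mathbb{R}^n_+\setminus\{0\})\times\mathbb{R}_+$ such that for all $i\in[n]$: $(\mathscr{A}x^{m-1})_i+t=0$ if $x_i>0$,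 and $(\mathscr{A}x^{m-1})_i+t\ge 0$ if $x_i=0$. $R_0$-tensor: there is no $x\in\mathbb{R}^n_+\setminus\{0\}$ such that for all $i\in[n]$: $(\mathscr{A}x^{m-1})_i=0$ if $x_i>0$, and $(\mathscr{A}x^{m-1})_i\ge 0$ if $x_i=0$. $ER$-tensor: there is no $(x,t)\in(\mathbb{R}^n_+\setminus\{0\})\times\mathbb{R}_+$ such that for all $i\in[n]$: $(\mathscr{A}x^{m-1})_i+tx_i=0$ if $x_i>0$, and $(\mathscr{A}x^{m-1})_i\ge 0$ if $x_i=0$. $Q$-tensor: for every $q\in\mathbb{R}^n$ the tensor complementarity problem TCP$(q,\mathscr{A})$ has a solution, i.e. there is $x\in\mathbb{R}^n$ with $x\ge 0$, $\mathscr{A}x^{m-1}+q\ge 0$, $x^T(\mathscr{A}x^{m-1}+q)=0$. *)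

(* Defs.v *)
From HB Require Import structures.
From mathcomp Require Import all_boot all_order all_algebra.
From mathcomp Require Import reals.

Set Implicit Arguments.
Unset Strict Implicit.
Unset Printing Implicit Defensive.

Import Order.TTheory GRing.Theory Num.Theory.
Local Open Scope ring_scope.

Definition tensor (R : realType) (m n : nat) : Type := {ffun m.-tuple 'I_n -> R}.

(* The entry at (i_1, ..., i_m) contributes to the coordinate i_1, with the
   monomial x_(i_2) ... x_(i_m). *)
Definition tensor_app (R : realType) (m n : nat) (A : tensor R m n)
    (x : 'cV[R]_n) : 'cV[R]_n :=
  \col_i \sum_(s : m.-tuple 'I_n | ohead s == Some i)
            A s * \prod_(j <- behead s) x j 0.

Definition nonneg_vec (R : realType) (n : nat) (x : 'cV[R]_n) : Prop :=
  forall i, 0 <= x i 0.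

Definition P0_function (R : realType) (n : nat)
    (f : 'cV[R]_n -> 'cV[R]_n) : Prop :=
  forall x y : 'cV[R]_n, x <> y ->
    exists i, x i 0 <> y i 0 /\ 0 <= (x i 0 - y i 0) * (f x i 0 - f y i 0).

(* The shift q cancels in P0_function, so quantifying over it is harmless. *)
Definition SP0_tensor (R : realType) (m n : nat) (A : tensor R m n) : Prop :=
  forall q : 'cV[R]_n, P0_function (fun x => tensor_app A x + q).

Definition R_tensor (R : realType) (m n : nat) (A : tensor R m n) : Prop :=
  ~ exists (x : 'cV[R]_n) (t : R),
      [/\ nonneg_vec x, x <> 0, 0 <= t
        & forall i, (0 < x i 0 -> tensor_app A x i 0 + t = 0) /\
                    (x i 0 = 0 -> 0 <= tensor_app A x i 0 + t)].

Definition R0_tensor (R : realType) (m n : nat) (A : tensor R m n) : Prop :=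
  ~ exists x : 'cV[R]_n,
      [/\ nonneg_vec x, x <> 0
        & forall i, (0 < x i 0 -> tensor_app A x i 0 = 0) /\
                    (x i 0 = 0 -> 0 <= tensor_app A x i 0)].

Definition ER_tensor (R : realType) (m n : nat) (A : tensor R m n) : Prop :=
  ~ exists (x : 'cV[R]_n) (t : R),
      [/\ nonneg_vec x, x <> 0, 0 <= t
        & forall i, (0 < x i 0 -> tensor_app A x i 0 + t * x i 0 = 0) /\
                    (x i 0 = 0 -> 0 <= tensor_app A x i 0)].

Definition TCP_solution (R : realType) (m n : nat) (q : 'cV[R]_n)
    (A : tensor R m n) (x : 'cV[R]_n) : Prop :=
  [/\ nonneg_vec x, nonneg_vec (tensor_app A x + q)
    & x^T *m (tensor_app A x + q) = 0].

Definition Q_tensor (R : realType) (m n : nat) (A : tensor R m n) : Prop :=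
  forall q : 'cV[R]_n, exists x : 'cV[R]_n, TCP_solution q A x.

(* Main.v *)
(* Write F x = A x^(m-1). The P0 inequality at (x, 0) forces t = 0 in the
   definitions of R- and ER-tensors, which gives R0 -> R -> ER. The hard step is
   ER -> Q, and only R0 is needed there. For a > 0 the map F x + a x + b q is a
   strict P-function, so the complementarity problem of this map on the box
   [0, 1]^n has exactly one solution x(a, b), by induction on the dimension and
   the intermediate value theorem. R0 and compactness exclude solutions with
   sum_i x_i = 1/2 for small a and b; as x(a, 0) = 0, connectedness along b keeps
   sum_i x_i below 1/2, so that the upper bounds of the box are not active.
   Letting a tend to 0 and rescaling by b = r^(m-1) solves TCP(q, A). *)
Require Import Defs.
From HB Require Import structures.
From mathcomp Require Import all_boot all_order all_algebra.
From mathcomp Require Import reals.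
From mathcomp Require Import boolp classical_sets topology normedtype derive lra.

Set Implicit Arguments.
Unset Strict Implicit.
Unset Printing Implicit Defensive.

Import Order.TTheory GRing.Theory Num.Theory.
Import numFieldNormedType.Exports.
Local Open Scope classical_set_scope.
Local Open Scope ring_scope.

(** * Closed conditions, minima on compact sets and connectedness of a segment *)

Section ClosedConditions.
Context {R : realType} {V : topologicalType}.
Implicit Types (f g : V -> R) (c : R).

Lemma continuous_funD f g : continuous f -> continuous g ->
  continuous (fun x => f x + g x).
Proof. by move=> cf cg x; exact: (cvgD (cf x) (cg x)). Qed.

Lemma continuous_funB f g : continuous f -> continuous g ->
  continuous (fun x => f x - g x).
Proof. by move=> cf cg x; exact: (cvgB (cf x) (cg x)). Qed.

Lemma continuous_funM f g : continuous f -> continuous g ->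
  continuous (fun x => f x * g x).
Proof. by move=> cf cg x; exact: (cvgM (cf x) (cg x)). Qed.

Lemma continuous_fun_sum (T : Type) (r : seq T) (P : pred T) (F : T -> V -> R) :
  (forall i, continuous (F i)) -> continuous (fun x => \sum_(i <- r | P i) F i x).
Proof. by move=> cF; apply: continuous_big => //; exact: add_continuous. Qed.

Lemma continuous_fun_prod (T : Type) (r : seq T) (P : pred T) (F : T -> V -> R) :
  (forall i, continuous (F i)) -> continuous (fun x => \prod_(i <- r | P i) F i x).
Proof. by move=> cF; apply: continuous_big => //; exact: mul_continuous. Qed.

Lemma closed_ge_fun f c : continuous f -> closed [set x | c <= f x].
Proof.
by move=> cf; apply: (@preimage_closed _ _ f [set y | c <= y]);
  [move=> x _; exact: cf | exact: closed_ge].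
Qed.

Lemma closed_le_fun f c : continuous f -> closed [set x | f x <= c].
Proof.
by move=> cf; apply: (@preimage_closed _ _ f [set y | y <= c]);
  [move=> x _; exact: cf | exact: closed_le].
Qed.

Lemma closed_eq_fun f c : continuous f -> closed [set x | f x = c].
Proof.
by move=> cf; apply: (@preimage_closed _ _ f [set y | y = c]);
  [move=> x _; exact: cf | exact: closed_eq].
Qed.

Lemma compact_minimum (K : set V) f :
  K !=set0 -> compact K -> continuous f ->
  exists2 c, K c & forall x, K x -> f c <= f x.
Proof.
move=> K0 cK cf.
have [|c /set_mem Kc cmin] := @compact_EVT_min _ _ f K K0 cK.
  exact: continuous_subspaceT.
by exists c => // x Kx; apply/cmin/mem_set.
Qed.

End ClosedConditions.

(** If [A] and [B] were disjoint on the segment, the trace of [A] would be cut out both by the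
    closed set [A] and by the open complement of [B]. By connectedness it would be the whole
    segment, including [b], which lies in [B]. *)
Lemma segment_closed_cover (R : realType) (A B : set R) (a b : R) :
  a <= b -> closed A -> closed B -> A a -> B b ->
  (forall s, a <= s <= b -> A s \/ B s) ->
  exists2 s, a <= s <= b & A s /\ B s.
Proof.
move=> ab cA cB Aa Bb AB; apply: contrapT => nAB.
have nAB' s : a <= s <= b -> A s -> ~ B s by move=> sab As Bs; apply: nAB; exists s.
have E : `[a, b] `&` A = `[a, b]%classic.
  apply: (@segment_connected R a b).
  - by exists a; split => //=; rewrite in_itv /= lexx.
  - exists (~` B); first by rewrite openC.
    apply/seteqP; split => s /= []; rewrite in_itv /= => sab As; split=> //.
      exact: nAB'.
    by case: (AB s sab).
  - by exists A.
have : (`[a, b] `&` A) b by rewrite E /= in_itv /= lexx andbT.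
by case=> _ /nAB'; apply=> //; rewrite lexx andbT.
Qed.

(* Neither the section of [p] nor its continuity is needed: the images under
   [p] of the sublevel and superlevel sets of [h] are closed and cover the
   segment, and injectivity turns a common value into a common point. *)
Lemma zero_along_compact_curve (R : realType) (V : topologicalType)
    (K : set V) (p h : V -> R) (a b : R) (x0 x1 : V) :
  compact K -> continuous p -> continuous h ->
  (forall x y, K x -> K y -> p x = p y -> x = y) ->
  (forall s, a <= s <= b -> exists2 x, K x & p x = s) ->
  a <= b -> K x0 -> p x0 = a -> h x0 <= 0 -> K x1 -> p x1 = b -> 0 <= h x1 ->
  exists2 x, K x & h x = 0.
Proof.
move=> cK cp ch pinj psurj ab K0 p0 h0 K1 p1 h1.
have cl C : closed C -> closed (p @` (K `&` C)).
  move=> cC; apply: compact_closed; first exact: Rhausdorff.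
  apply: continuous_compact; last exact: compact_closedI.
  exact: continuous_subspaceT.
have clA := cl _ (closed_le_fun (c := 0) ch).
have clB := cl _ (closed_ge_fun (c := 0) ch).
have [||s /psurj[x Kx <-]|s _ [[x [Kx hx] <-] [y [Ky hy] /pinj]]] :=
  segment_closed_cover ab clA clB.
- by exists x0.
- by exists x1.
- by case/orP: (le_total (h x) 0) => hx; [left|right]; exists x.
move=> /(_ Ky Kx) yx; exists x => //; apply/eqP; rewrite eq_le.
by move: hx hy => /= ->; rewrite yx.
Qed.

(** * Complementarity problems on the unit box *)

Section BoxComplementarity.
Context {R : realType} {I : eqType}.
Notation V := {ptws I -> R}.
Variable G : I -> V -> R.
Hypothesis cG : forall i, continuous (G i).

Lemma coord_ptws_continuous (i : I) : continuous (fun x : V => x i).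
Proof. exact (@proj_continuous I (fun=> R) i). Qed.

Definition unit_box : set V := [set x | forall i, `[0, 1]%classic (x i)].

Lemma unit_boxP (x : V) : unit_box x <-> forall i, 0 <= x i <= 1.
Proof. by split=> + i => /(_ i); rewrite /= in_itv. Qed.

Lemma compact_unit_box : compact unit_box.
Proof.
apply: (@tychonoff I (fun=> R) (fun=> `[0, 1]%classic)) => i.
exact: segment_compact.
Qed.

(* For [x] in the box: [G i x >= 0] if [x i < 1] and [G i x <= 0] if [0 < x i],
   written as closed conditions. *)
Definition box_compl (l : seq I) : set V :=
  [set x | unit_box x /\
    forall i, i \in l -> 0 <= (1 - x i) * G i x /\ x i * G i x <= 0].

(** The indices in [l] are the free coordinates; [w] prescribes all the others. *)
Definition agree_off (l : seq I) (w : V) : set V :=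
  [set x | forall i, i \notin l -> x i = w i].

Definition strict_P_on (l : seq I) (w : V) : Prop :=
  forall x y, agree_off l w x -> agree_off l w y -> x <> y ->
  exists2 i, x i <> y i & 0 < (x i - y i) * (G i x - G i y).

Lemma compact_box_compl l : compact (box_compl l).
Proof.
have -> : box_compl l = unit_box `&`
    \bigcap_(i in [set i | i \in l])
      ([set x | 0 <= (1 - x i) * G i x] `&` [set x | x i * G i x <= 0]).
  by apply/seteqP; split=> x [].
apply: compact_closedI; first exact: compact_unit_box.
apply: closed_bigI => i _; apply: closedI.
  apply/closed_ge_fun/continuous_funM; last exact: cG.
  by apply: continuous_funB; [exact: cst_continuous | exact: coord_ptws_continuous].
by apply/closed_le_fun/continuous_funM; [exact: coord_ptws_continuous | exact: cG].
Qed.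

Lemma closed_agree_off l w : closed (agree_off l w).
Proof.
have -> : agree_off l w = \bigcap_(i in [set i | i \notin l]) [set x | x i = w i].
  by apply/seteqP; split=> x.
by apply: closed_bigI => i _; apply/closed_eq_fun/coord_ptws_continuous.
Qed.

(** Where [x i < y i], the upper bound is inactive at [x] and the lower one at [y], so
    [G i y <= 0 <= G i x]; the other case is symmetric. Hence no free coordinate gives the positive
    product that [strict_P_on] asks for. *)
Lemma box_compl_unique l w x y : strict_P_on l w ->
  box_compl l x -> box_compl l y -> agree_off l w x -> agree_off l w y -> x = y.
Proof.
move=> PG [/unit_boxP bx sx] [/unit_boxP b_y sy] ax ay; apply: contrapT => xy.
have [i xyi] := PG x y ax ay xy.
have il : i \in l by apply: contrapT => /negP il; apply: xyi; rewrite ax ?ay.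
move: (bx i) (b_y i) (sx i il) (sy i il) => /andP[x0 x1] /andP[y0 y1] [u1 u2] [v1 v2].
case: (ltgtP (x i) (y i)) => [lt|lt|//].
- have : 0 <= G i x by rewrite -(pmulr_rge0 _ (_ : 0 < 1 - x i)) //; lra.
  have : G i y <= 0 by rewrite -(pmulr_rle0 _ (_ : 0 < y i)) //; lra.
  by nra.
- have : 0 <= G i y by rewrite -(pmulr_rge0 _ (_ : 0 < 1 - y i)) //; lra.
  have : G i x <= 0 by rewrite -(pmulr_rle0 _ (_ : 0 < x i)) //; lra.
  by nra.
Qed.

(* Induction on the free coordinates: freeing one more coordinate [k] amounts to
   a one-dimensional problem along the curve of solutions with [x k] prescribed. *)
Lemma box_compl_exists l w : uniq l -> unit_box w -> strict_P_on l w ->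
  exists2 x, box_compl l x & agree_off l w x.
Proof.
elim: l w => [|k l IH] w /=; first by move=> _ bw _; exists w.
move=> /andP[kl ul] bw PG.
pose up (s : R) : V := @dfwith I (fun=> R) w k s.
have upk s : up s k = s by rewrite /up dfwith_in.
have upN s i : i != k -> up s i = w i by move=> ik; rewrite /up dfwith_out // eq_sym.
have aup s x : agree_off l (up s) x -> agree_off (k :: l) w x /\ x k = s.
  move=> ax; split; last by rewrite ax.
  by move=> i; rewrite inE negb_or => /andP[ik il]; rewrite ax // upN.
have aup' x : agree_off (k :: l) w x -> agree_off l (up (x k)) x.
  move=> ax i il; have [->|ik] := eqVneq i k; first by rewrite upk.
  by rewrite upN // ax // inE negb_or ik.
have Pup s : strict_P_on l (up s).
  by move=> x y /aup[ax _] /aup[ay _]; exact: PG.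
(* [K] is the curve of partial solutions: exactly one point for each value of [x k] in [0, 1]. *)
pose K := box_compl l `&` agree_off (k :: l) w.
have exK s : 0 <= s <= 1 -> exists2 x, K x & x k = s.
  move=> s01; have [|x Kx /aup[ax xk]] := IH (up s) ul _ (Pup s); last by exists x.
  apply/unit_boxP => i; have [->|ik] := eqVneq i k; first by rewrite upk.
  by rewrite upN //; apply: (iffLR (unit_boxP w)).
have KU x y : K x -> K y -> x k = y k -> x = y.
  move=> [sx ax] [sy ay] xy; apply: (box_compl_unique (Pup (x k))) => //.
    exact: aup'.
  by rewrite xy; exact: aup'.
have ext x : K x -> 0 <= (1 - x k) * G k x -> x k * G k x <= 0 ->
    exists2 x, box_compl (k :: l) x & agree_off (k :: l) w x.
  move=> [[bx sx] ax] h1 h2; exists x => //; split=> // i.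
  by rewrite inE => /orP[/eqP->|/sx].
have [|x0 K0 x0k] := exK 0; first by rewrite lexx ler01.
have [|x1 K1 x1k] := exK 1; first by rewrite lexx ler01.
(* An end of the curve with the right sign of [G k] is already complementary at [k]. Otherwise [G k]
   is negative at the start and positive at the end, hence vanishes in between. *)
have [h0|h0] := leP 0 (G k x0).
  by apply: (ext x0 K0); rewrite x0k; lra.
have [h1|h1] := leP (G k x1) 0.
  by apply: (ext x1 K1); rewrite x1k; lra.
have cK : compact K.
  by apply: compact_closedI; [exact: compact_box_compl | exact: closed_agree_off].
have [x Kx Gx] := zero_along_compact_curve cK (@coord_ptws_continuous k)
  (cG (i := k)) KU exK ler01 K0 x0k (ltW h0) K1 x1k (ltW h1).
by apply: (ext x Kx); rewrite Gx mulr0.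
Qed.

End BoxComplementarity.

(** * Homogeneity of the tensor map and consequences of the P0 inequality *)

Section TensorApp.
Context {R : realType} {m n : nat} (A : tensor R m n).
Hypothesis hm : (1 < m)%N.

Lemma tensor_appZ (c : R) (x : 'cV[R]_n) :
  tensor_app A (c *: x) = c ^+ m.-1 *: tensor_app A x.
Proof.
apply/colP => i; rewrite !mxE mulr_sumr; apply: eq_bigr => s _.
rewrite mulrCA; congr (_ * _).
under eq_bigr do rewrite mxE.
rewrite big_split /= big_const_seq count_predT size_behead size_tuple.
by rewrite iter_mulr_1.
Qed.

Lemma tensor_app0 : tensor_app A 0 = 0.
Proof.
rewrite -[0 in LHS](scale0r 0) tensor_appZ -subn1 expr0n subn_eq0.
by rewrite leqNgt hm scale0r.
Qed.

Lemma continuous_tensor_app (V : topologicalType) (f : V -> 'cV[R]_n) (i : 'I_n) :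
  (forall j, continuous (fun v => f v j 0)) ->
  continuous (fun v => tensor_app A (f v) i 0).
Proof.
move=> cf.
have -> : (fun v => tensor_app A (f v) i 0) =
    (fun v => \sum_(s : m.-tuple 'I_n | ohead s == Some i)
       A s * \prod_(j <- behead s) f v j 0).
  by apply/funext => v; rewrite mxE.
apply: continuous_fun_sum => s; apply: continuous_funM; first exact: cst_continuous.
exact: continuous_fun_prod.
Qed.

Hypothesis hA : SP0_tensor A.

Lemma SP0_P0 : P0_function (tensor_app A).
Proof.
by move=> x y /(hA 0)[i []]; rewrite !addr0 => xy h; exists i.
Qed.

Lemma SP0_nonneg (x : 'cV[R]_n) : nonneg_vec x -> x <> 0 ->
  exists2 i, 0 < x i 0 & 0 <= tensor_app A x i 0.
Proof.
move=> x0 /SP0_P0[i]; rewrite tensor_app0; move: (tensor_app A x) => F.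
rewrite !mxE !subr0 => -[/eqP xi h].
have xi0 : 0 < x i 0 by rewrite lt_neqAle eq_sym xi x0.
by exists i => //; rewrite pmulr_rge0 in h.
Qed.

Lemma SP0_R0_R : R0_tensor A -> R_tensor A.
Proof.
move=> R0 [x [t [x0 xN t0 h]]]; have [i xi Ai] := SP0_nonneg x0 xN.
have tE : t = 0 by have [/(_ xi)] := h i; lra.
by apply: R0; exists x; split=> // j; have := h j; rewrite tE addr0.
Qed.

Lemma SP0_R_ER : R_tensor A -> ER_tensor A.
Proof.
move=> RA [x [t [x0 xN t0 h]]]; have [i xi Ai] := SP0_nonneg x0 xN.
have tE : t = 0 by have [/(_ xi)] := h i; nra.
apply: RA; exists x, 0; split=> // j; have := h j.
by rewrite tE mul0r addr0.
Qed.

Lemma TCP_solutionP (q x : 'cV[R]_n) :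
  TCP_solution q A x <->
  nonneg_vec x /\ forall i, 0 <= tensor_app A x i 0 + q i 0 /\
                            (0 < x i 0 -> tensor_app A x i 0 + q i 0 = 0).
Proof.
rewrite /TCP_solution; move: (tensor_app A x) => F.
split=> [[x0 y0 xy]|[x0 h]]; last first.
  split=> //; first by move=> i; rewrite mxE; have [] := h i.
  apply/matrixP => i j; rewrite !ord1 !mxE big1 // => k _; rewrite !mxE.
  have [xk|xk] := ltP 0 (x k 0); first by have [_ ->] := h k; rewrite ?mulr0.
  by have -> : x k 0 = 0; rewrite ?mul0r //; apply/eqP; rewrite eq_le xk x0.
split=> // i; split; first by have := y0 i; rewrite mxE.
move=> xi; move/matrixP/(_ 0 0): xy; rewrite !mxE => /eqP.
rewrite psumr_eq0 => [/allP/(_ i (mem_index_enum i))|j _]; last first.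
  by apply: mulr_ge0; [rewrite mxE | exact: y0].
by rewrite !mxE mulf_eq0 gt_eqF //= => /eqP.
Qed.

(* If [x] is a nonzero solution of TCP(0, A), then TCP(q, A) has no solution [y]
   for [q] equal to [-1] on the support of [x] and to [1] elsewhere: compare [y]
   with a multiple of [x] that exceeds [y] on the support of [x]. *)
Lemma SP0_Q_R0 : Q_tensor A -> R0_tensor A.
Proof.
move=> QA [x [x0 xN hx]].
pose q : 'cV[R]_n := \col_i if 0 < x i 0 then -1 else 1.
have [y /TCP_solutionP[y0 hy]] := QA q.
(* A sum of nonnegative ratios dominates each of them, so it serves as their maximum would. *)
pose c := \sum_i (if 0 < x i 0 then (y i 0 + 1) / x i 0 else 0).
have term0 i : 0 <= if 0 < x i 0 then (y i 0 + 1) / x i 0 else 0.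
  by case: ifP => // xi; rewrite divr_ge0 // addr_ge0.
have cx i : 0 < x i 0 -> y i 0 + 1 <= c * x i 0.
  move=> xi; rewrite -ler_pdivrMr // /c (bigD1 i) //= xi lerDl.
  exact: sumr_ge0.
have c0 : 0 <= c by exact: sumr_ge0.
have [i0 xi0] : exists i, 0 < x i 0.
  by have [i xi _] := SP0_nonneg x0 xN; exists i.
have xy : c *: x <> y by move=> /colP/(_ i0); rewrite mxE; have := cx _ xi0; lra.
have [i] := SP0_P0 xy; rewrite tensor_appZ.
have [] := hy i; have [] := hx i.
move: (tensor_app A x) (tensor_app A y) => F F' hx1 hx2 hy1 hy2 [].
(* On the support of [x], [c x_i - y_i >= 1], while the value at [c x] is 0 and the one at [y] is at
   least 1. Off it, [c x_i = 0 < y_i], while the value at [c x] is nonnegative and the one at [y] is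
   -1. Both products are negative, against P0. *)
move: hy1 hy2; rewrite !mxE; have [xi|xi] := ltP 0 (x i 0).
  by rewrite hx1 // mulr0 => hy1 _; have := cx _ xi; nra.
have xiE : x i 0 = 0 by apply/eqP; rewrite eq_le xi x0.
rewrite xiE mulr0 => hy1 hy2 cxy.
have yi : 0 < y i 0 by rewrite lt_neqAle y0 andbT; apply/eqP.
have cF : 0 <= c ^+ m.-1 * F i 0.
  by apply: mulr_ge0; [exact: exprn_ge0 | exact: hx2].
by have := hy2 yi; nra.
Qed.

End TensorApp.

(** * The perturbed problem and the passage from R0 to solvability *)

Section Homotopy.
Context {R : realType} {m n : nat} (A : tensor R m n) (q : 'cV[R]_n).
Hypotheses (hm : (1 < m)%N) (hA : SP0_tensor A) (hR0 : R0_tensor A).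

(* A point of [V] packs [x] with the two parameters [a] and [b] (at the indices
   [None] and [Some None]) of the map [A x^(m-1) + a x + b q]. *)
Notation V := {ptws option (option 'I_n) -> R}.

Definition xpart (v : V) : 'cV[R]_n := \col_i v (Some (Some i)).

(** With the parameters as coordinates, the solutions for all [(a, b)] in the unit square form a
    single compact set, and prescribing [(a, b)] is an [agree_off] condition. *)
Definition homotopy (o : option (option 'I_n)) (v : V) : R :=
  if o is Some (Some i) then
    tensor_app A (xpart v) i 0 + v None * v (Some (Some i)) + v (Some None) * q i 0
  else 0.

Definition xcoords : seq (option (option 'I_n)) :=
  [seq Some (Some i) | i <- enum 'I_n].

Definition xsum (v : V) : R := \sum_i v (Some (Some i)).

Notation sol := (box_compl homotopy xcoords).

Lemma mem_xcoords i : Some (Some i) \in xcoords.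
Proof. by apply/mapP; exists i; rewrite ?mem_enum. Qed.

Lemma xcoordsN o : o \notin xcoords -> o = None \/ o = Some None.
Proof. by case: o => [[i|]|]; [rewrite mem_xcoords | right | left]. Qed.

Lemma uniq_xcoords : uniq xcoords.
Proof. by rewrite map_inj_uniq ?enum_uniq // => i j []. Qed.

Lemma continuous_xsum : continuous xsum.
Proof. by apply: continuous_fun_sum => i; exact: coord_ptws_continuous. Qed.

Lemma continuous_homotopy o : continuous (homotopy o).
Proof.
case: o => [[i|]|]; try exact: cst_continuous.
apply: continuous_funD; last first.
  by apply: continuous_funM; [exact: coord_ptws_continuous | exact: cst_continuous].
apply: continuous_funD; last first.
  by apply: continuous_funM; exact: coord_ptws_continuous.
apply: continuous_tensor_app => j.
have -> : (fun v => xpart v j 0) = (fun v => v (Some (Some j))).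
  by apply/funext => v; rewrite mxE.
exact: coord_ptws_continuous.
Qed.

(** The index given by P0 works: for equal parameters the term [b q] cancels, and [a x] adds
    [a (x_i - y_i)^2 > 0]. *)
Lemma homotopy_strict_P (w : V) : 0 < w None -> strict_P_on homotopy xcoords w.
Proof.
move=> w0 x y ax ay xy.
have aE o : o \notin xcoords -> x o = w o /\ y o = w o by move=> oN; rewrite ax ?ay.
have [xN yN] := aE None ltac:(by apply/mapP => -[]).
have [xS yS] := aE (Some None) ltac:(by apply/mapP => -[]).
have xy' : xpart x <> xpart y.
  move=> /colP E; apply: xy; apply/funext => -[[i|]|]; rewrite ?xN ?xS //.
  by have := E i; rewrite !mxE.
have [i] := SP0_P0 hA xy'.
rewrite /homotopy xN yN xS yS.
move: (tensor_app A (xpart x)) (tensor_app A (xpart y)) => F F'.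
rewrite !mxE => -[xyi h]; exists (Some (Some i)); rewrite ?xN ?xS ?yN ?yS //.
have : 0 < w None * (x (Some (Some i)) - y (Some (Some i))) ^+ 2.
  by rewrite mulr_gt0 // exprn_even_gt0 //= subr_eq0; apply/eqP.
nra.
Qed.

Lemma sol_interior (v : V) i : sol v -> v (Some (Some i)) < 1 ->
  [/\ 0 <= v (Some (Some i)), 0 <= homotopy (Some (Some i)) v &
      0 < v (Some (Some i)) -> homotopy (Some (Some i)) v = 0].
Proof.
move=> [/unit_boxP/(_ (Some (Some i)))/andP[v0 _] /(_ _ (mem_xcoords i))].
move: (homotopy _ _) => h [h1 h2] v1.
have h0 : 0 <= h by rewrite pmulr_rge0 // subr_gt0 in h1.
split=> // vi; apply/eqP; rewrite eq_le h0 andbT.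
by rewrite pmulr_rle0 in h2.
Qed.

Lemma xsum_ge (v : V) i : unit_box v -> v (Some (Some i)) <= xsum v.
Proof.
move=> /unit_boxP bv; rewrite /xsum (bigD1 i) //= lerDl.
by apply: sumr_ge0 => j _; case/andP: (bv (Some (Some j))).
Qed.

(** A coordinate sum of 1/2 keeps the nonnegative coordinates below 1 and not all zero, so at
    [a = b = 0] such a point would be a nonzero solution of TCP(0, A), against R0. *)
Lemma no_half_sol (v : V) : sol v -> xsum v = 1 / 2 -> v None = 0 ->
  v (Some None) = 0 -> False.
Proof.
move=> sv vh v0 v1; apply: hR0; exists (xpart v).
have vi i : v (Some (Some i)) < 1.
  by have := xsum_ge i sv.1; lra.
split.
- by move=> i; rewrite mxE; have [] := sol_interior sv (vi i).
- move=> /colP E; move: vh; rewrite /xsum big1 => [|i _]; first lra.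
  by have := E i; rewrite !mxE.
- move=> i; rewrite [xpart v i 0]mxE; have [_] := sol_interior sv (vi i).
  by rewrite /homotopy v0 v1 !mul0r !addr0.
Qed.

(** [mu] is the minimum of [a + b] over the compact set of solutions with sum 1/2; [no_half_sol]
    makes it positive. *)
Lemma sol_half_bound : exists2 mu : R, 0 < mu &
  forall v : V, sol v -> xsum v = 1 / 2 -> mu <= v None + v (Some None).
Proof.
pose C := sol `&` [set v | xsum v = 1 / 2].
have [[v Cv]|C0] := pselect (C !=set0); last first.
  by exists 1 => // v sv vh; case: C0; exists v.
have cC : compact C.
  apply: compact_closedI; first exact/compact_box_compl/continuous_homotopy.
  exact/closed_eq_fun/continuous_xsum.
have [|||c [sc ch] cmin] := @compact_minimum R _ C (fun v => v None + v (Some None)).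
- by exists v.
- exact: cC.
- by apply: continuous_funD; exact: coord_ptws_continuous.
exists (c None + c (Some None)); last by move=> u su uh; apply: cmin.
have /unit_boxP bc := sc.1.
have /andP[c0 _] := bc None; have /andP[c1 _] := bc (Some None).
rewrite lt_neqAle addr_ge0 // andbT eq_sym paddr_eq0 //.
by apply/negP => /andP[/eqP cN /eqP cS]; exact: (no_half_sol sc ch).
Qed.

Definition param (a b : R) : V :=
  fun o => match o with None => a | Some None => b | Some (Some _) => 0 end.

Lemma sol_param0 a : 0 <= a <= 1 -> sol (param a 0).
Proof.
move=> a01; split; first by apply/unit_boxP => -[[i|]|] //=; rewrite lexx ler01.
move=> o /mapP[i _ ->]; rewrite /homotopy /= mulr0 mul0r !addr0.
have -> : xpart (param a 0) = 0 by apply/colP => j; rewrite !mxE.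
by rewrite tensor_app0 // mxE !mulr0.
Qed.

Lemma small_sol : exists2 mu : R, 0 < mu & forall a b : R,
  0 < a -> 0 <= b -> a + b < mu -> a <= 1 -> b <= 1 ->
  exists v : V, [/\ sol v, v None = a, v (Some None) = b & xsum v <= 1 / 2].
Proof.
have [mu mu0 hmu] := sol_half_bound; exists mu => // a b a0 b0 abmu a1 b1.
pose K := sol `&` ([set v | v None = a] `&` [set v | v (Some None) <= b]).
have cK : compact K.
  apply: compact_closedI; first exact/compact_box_compl/continuous_homotopy.
  apply: closedI; first exact/closed_eq_fun/coord_ptws_continuous.
  exact/closed_le_fun/coord_ptws_continuous.
have agr (v : V) c : v None = a -> v (Some None) = c -> agree_off xcoords (param a c) v.
  by move=> va vc o /xcoordsN[]->.
have exK s : 0 <= s <= b -> exists2 v, K v & v (Some None) = s.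
  move=> /andP[s0 sb].
  have [||v sv av] := @box_compl_exists R _ homotopy continuous_homotopy xcoords
    (param a s) uniq_xcoords.
  - apply/unit_boxP => -[[i|]|] /=; rewrite ?lexx ?ler01 ?s0 ?(le_trans sb) //.
    by rewrite (ltW a0).
  - exact: homotopy_strict_P.
  have vS : v (Some None) = s by rewrite av //; apply/mapP => -[].
  exists v => //; split=> //; split=> /=; last by rewrite vS.
  by rewrite av //; apply/mapP => -[].
have KU (x y : V) : K x -> K y -> x (Some None) = y (Some None) -> x = y.
  move=> [sx [xa _]] [sy [ya _]] xy.
  have wP := @homotopy_strict_P (param a (x (Some None))) a0.
  exact: (box_compl_unique wP sx sy (agr _ _ xa erefl) (agr _ _ ya (esym xy))).
have [|v Kv vb] := exK b; first by rewrite b0 lexx.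
have [_ [va _]] := Kv.
(* If the sum at [b] exceeded 1/2, then along the curve of solutions for this [a], which starts at
   [x = 0], it would equal 1/2 at a parameter at most [b]. There the two parameters add up to less
   than [mu], against [sol_half_bound]. *)
have [vh|vh] := leP (xsum v) (1 / 2); first by exists v; split=> //; exact: Kv.1.
have K0 : K (param a 0) by split; [apply: sol_param0; rewrite (ltW a0) | split].
have ch : continuous (fun v => xsum v - 1 / 2).
  by apply: continuous_funB; [exact: continuous_xsum | exact: cst_continuous].
have [||x [sx [xa xb]] xh] := zero_along_compact_curve cK
  (@coord_ptws_continuous _ _ (Some None)) ch KU exK b0 K0 erefl _ Kv vb.
- by rewrite /xsum big1 //; lra.
- by rewrite subr_ge0 ltW.
have : mu <= x None + x (Some None) by apply: hmu => //; lra.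
by move: xa xb => /= -> xb; lra.
Qed.

(** The limit [a = 0] is reached by minimizing [a] over the compact set of solutions with this [b]
    and sum at most 1/2: by [small_sol] the minimum is below every positive number. *)
Lemma limit_sol : exists2 mu : R, 0 < mu & forall b : R, 0 < b -> b < mu ->
  exists v : V, [/\ sol v, v None = 0, v (Some None) = b & xsum v <= 1 / 2].
Proof.
have [mu mu0 hmu] := small_sol.
exists (Num.min mu 1); first by rewrite lt_min mu0 ltr01.
move=> b b0; rewrite lt_min => /andP[bmu b1].
pose K := sol `&` ([set v | v (Some None) = b] `&` [set v | xsum v <= 1 / 2]).
have cK : compact K.
  apply: compact_closedI; first exact/compact_box_compl/continuous_homotopy.
  apply: closedI; first exact/closed_eq_fun/coord_ptws_continuous.
  exact/closed_le_fun/continuous_xsum.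
have exK e : 0 < e -> exists2 v, K v & v None <= e.
  (* The three bounds give [a <= e], keep [a] inside the box, and ensure [a + b < mu]. *)
  move=> e0; pose a := Num.min e (Num.min 1 ((mu - b) / 2)).
  have [|||v [sv va vb vh]] := hmu a b _ (ltW b0) _ _ (ltW b1).
  - by rewrite /a !lt_min e0 ltr01 /=; lra.
  - suff : a <= (mu - b) / 2 by lra.
    by rewrite /a !ge_min lexx !orbT.
  - by rewrite /a !ge_min lexx !orbT.
  - by exists v => //; rewrite va /a ge_min lexx.
have [|c [sc [cb ch]] cmin] := compact_minimum _ cK (@coord_ptws_continuous R _ None).
  by have [v Kv _] := exK 1 ltr01; exists v.
exists c; split=> //; have /unit_boxP/(_ None)/andP[c0 _] := sc.1.
apply/eqP; rewrite eq_le c0 andbT; apply/ler_addgt0Pl => e /exK[v Kv ve].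
by rewrite addr0 (le_trans (cmin v Kv)).
Qed.

Lemma SP0_R0_TCP : exists x, TCP_solution q A x.
Proof.
have [mu mu0 hmu] := limit_sol.
(* As [r <= 1] and [m - 1 >= 1], the parameter [b = r^(m-1)] is at most [r], hence below [mu]. *)
pose r := Num.min (mu / 2) (1 / 2).
have r0 : 0 < r by rewrite lt_min; apply/andP; split; lra.
have r1 : r <= 1 by rewrite ge_min; apply/orP; right; lra.
have rmu : r ^+ m.-1 < mu.
  have : r <= mu / 2 by rewrite ge_min lexx.
  suff : r ^+ m.-1 <= r by lra.
  have m10 : (0 < m.-1)%N by rewrite -subn1 subn_gt0.
  by rewrite -[leRHS]expr1 ler_wiXn2l // ltW.
have [v [sv va vb vh]] := hmu _ (exprn_gt0 _ r0) rmu.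
exists (r^-1 *: xpart v); apply/TCP_solutionP; rewrite tensor_appZ.
have v1 i : v (Some (Some i)) < 1 by have := xsum_ge i sv.1; lra.
have rd0 := exprn_gt0 m.-1 r0.
(* By homogeneity, [F x + r^(m-1) q = r^(m-1) (F (x / r) + q)], so signs and zeros carry over to
   [x / r]. *)
have hE i : homotopy (Some (Some i)) v =
    r ^+ m.-1 * ((r^-1 ^+ m.-1 *: tensor_app A (xpart v)) i 0 + q i 0).
  rewrite /homotopy va vb mul0r addr0; move: (tensor_app A _) => F.
  rewrite mxE mulrDr mulrA exprVn mulfV ?mul1r //.
  exact: lt0r_neq0.
move: (_ *: tensor_app A _) hE => F hE.
split=> i; have [vi h1 h2] := sol_interior sv (v1 i).
  by rewrite !mxE mulr_ge0 // invr_ge0 ltW.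
rewrite hE in h1; rewrite hE in h2; split; first by rewrite pmulr_rge0 in h1.
rewrite !mxE pmulr_rgt0 ?invr_gt0 // => /h2/eqP.
by rewrite mulf_eq0 gt_eqF //= => /eqP.
Qed.

End Homotopy.

(** * The cycle of implications *)

Lemma SP0_ER_Q (R : realType) (m n : nat) (A : tensor R m n) :
  (1 < m)%N -> SP0_tensor A -> ER_tensor A -> Q_tensor A.
Proof.
move=> hm hA ERA q; apply: SP0_R0_TCP => // -[x [x0 xN h]].
(* A vector that violates R0 violates ER with [t = 0]. *)
apply: ERA; exists x, 0; split=> // i; have [h1 h2] := h i.
by split=> // xi; rewrite mul0r addr0 h1.
Qed.

Theorem theorem3p1 (R : realType) (m n : nat) (hm : (3 <= m)%N) (hn : (2 <= n)%N)
    (A : tensor R m n) (hA : SP0_tensor A) :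
  [<-> R0_tensor A; R_tensor A; ER_tensor A; Q_tensor A].
Proof.
have m1 : (1 < m)%N by exact: ltnW.
tfae; [exact: SP0_R0_R | exact: SP0_R_ER | exact: SP0_ER_Q | exact: SP0_Q_R0].
Qed.
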